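(* Let $\mathbb{F}$ be a field and let $n \geq p \geq r>0$ be integers. Assume that $|\mathbb{F}|>r+1$. Then $$d^{=}_r(n,p)=\binom{r}{2}+r(n-r),$$ where $d^{=}_r(n,p)$ denotes the greatest possible dimension of an affine subspace of $\mathrm{M}_{n,p}(\mathbb{F})$ in which every matrix has rank $r$.
   Context: $\mathrm{M}_{n,p}(\mathbb{F})$ is the $\mathbb{F}$-vector space of all matrices with $n$ rows, $p$ columns and entries in $\mathbb{F}$. The field $\mathbb{F}$ is arbitrary (finite or infinite, subject to the cardinality condition stated). An affine subspace is a nonempty translate $A+V$ of a linear subspace $V$ of $\mathrm{M}_{n,p}(\mathbb{F})$; its dimension is $\dim_{\mathbb{F}} V$. Here $\binom{1}{2}=0$. *)

(* Defs.v *)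
From HB Require Import structures.
From mathcomp Require Import all_boot all_order all_algebra.

Set Implicit Arguments.
Unset Strict Implicit.
Unset Printing Implicit Defensive.

Import GRing.Theory.
Local Open Scope ring_scope.

(* |T| > k for a possibly infinite T: T has more than k distinct elements. *)
Definition card_gt (T : eqType) (k : nat) : Prop :=
  exists s : seq T, uniq s /\ (k < size s)%N.

Section AffineSubspaces.
Variables (F : fieldType) (n p : nat).

Definition translate (A : 'M[F]_(n, p)) (V : {vspace 'M[F]_(n, p)}) :
    {pred 'M[F]_(n, p)} :=
  [pred M | M - A \in V].

Definition affine_subspace_of_dim (S : {pred 'M[F]_(n, p)}) (d : nat) : Prop :=
  exists (A : 'M[F]_(n, p)) (V : {vspace 'M[F]_(n, p)}),
    S =i translate A V /\ \dim V = d.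

Definition constant_rank (r : nat) (S : {pred 'M[F]_(n, p)}) : Prop :=
  {in S, forall M, \rank M = r}.

Definition constant_rank_affine_dim (r d : nat) : Prop :=
  exists S : {pred 'M[F]_(n, p)},
    affine_subspace_of_dim S d /\ constant_rank r S.

End AffineSubspaces.

Definition is_greatest (P : nat -> Prop) (m : nat) : Prop :=
  P m /\ forall d : nat, P d -> (d <= m)%N.

(* The relation d^=_r(n,p) = d over F; the greatest dimension is unique. *)
Definition max_constant_rank_affine_dim
    (F : fieldType) (n p r d : nat) : Prop :=
  is_greatest (@constant_rank_affine_dim F n p r) d.

(* Main.v *)
Require Import Defs.
From mathcomp Require Import all_boot all_order all_algebra.

(** The bound is attained by the matrices [pid_mx r + N], where [N] is strictly
    lower triangular and supported on its first [r] columns: such a matrix is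
    the product of a unitriangular matrix and [pid_mx r], and the admissible
    positions of [N] number 'C(r, 2) + r * (n - r).

    For the upper bound, left and right multiplication by invertible matrices
    bring one point of the affine space to [pid_mx r].  Write an element of the
    direction space [V] in blocks as [N = block_mx K C B D], with [K] of size
    [r].  The pencil [pid_mx r + t *: N] has rank [r] for every scalar [t], so
    its minors of order [r + 1] that border the identity block vanish for every
    [t].  They are polynomials in [t] of degree at most [r + 1], divisible by
    [t]; since the field has at least [r + 1] nonzero elements, they vanish
    identically, and their coefficients of degree 1 and 2 give [D = 0] and
    [B *m C = 0] (border_of_rank_pencil).

    Count dimensions along [B], then [C], then [K].  If [B] is the block of some
    element of [V], and [C] that of an element whose own block [B] is zero, then
    adding the two elements shows that [B *m C = 0].  The trace pairing then
    bounds the total dimension of these [B] and [C] by [r * (n - r)]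
    (dim_annihilating_pair); this is where [p <= n] enters.  The elements of [V]
    with [B = 0] and [C = 0] are determined by [K], and [1%:M + K] is
    invertible for all of them.

    It remains to see that a linear space of [n]-by-[n] matrices [M] with all
    [1%:M + M] invertible has dimension at most 'C(n, 2)
    (dim_le_of_unit_translate).  For some index [i] this space contains no
    nonzero matrix supported on row [i]; for otherwise, choosing one such matrix
    for each row and a vector [x] orthogonal to none of the chosen rows, a
    combination [N] of these matrices satisfies [N *m x = - x].  Imposing that
    column [i] vanishes off the diagonal costs [n - 1] dimensions, it forces the
    diagonal entry to vanish too, and deleting row and column [i] is then
    injective, so induction applies. *)

Set Implicit Arguments.
Unset Strict Implicit.
Unset Printing Implicit Defensive.
Import GRing.Theory.
Local Open Scope ring_scope.

(** * Linear spaces of matrices without nonzero eigenvalues *)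

Lemma card_gt_notin (T : eqType) k (b : seq T) :
  card_gt T k -> (size b <= k)%N -> exists a, a \notin b.
Proof.
case=> s [us lt_ks] le_bk.
have /allPn[a _ nba] : ~~ all (mem b) s.
  apply/negP=> /allP sub_sb.
  by have := leq_trans lt_ks (leq_trans (uniq_leq_size us sub_sb) le_bk); rewrite ltnn.
by exists a.
Qed.

(** A vector space over a large enough field is not the union of a few
    hyperplanes: on a line that lies in none of the given hyperplanes, each of
    them meets at most one point. *)
Lemma exists_generic_vector (F : fieldType) m (L : seq 'rV[F]_m) :
    card_gt F (size L) -> all (predC1 0) L ->
  exists x : 'cV_m, all (fun l => l *m x != 0) L.
Proof.
case=> s0 [us0 lt_s0]; have {s0 us0 lt_s0} : exists k, card_gt F k /\ (size L <= k)%N.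
  by exists (size L); split=> //; exists s0.
case=> k [Fk]; elim: L => [|l L IHL] /=; first by exists 0.
move=> leLk /andP[nz_l nz_L].
have [x Hx] := IHL (ltnW leLk) nz_L.
have [j nz_lj] : exists j, l 0 j != 0 by apply/rV0Pn.
pose y : 'cV[F]_m := delta_mx j 0.
have ly : (l *m y) 0 0 != 0.
  by rewrite -colE mxE.
(* The only scalar a for which l' *m (x + a *: y) can vanish. *)
pose bad (l' : 'rV[F]_m) := - (l' *m x) 0 0 / (l' *m y) 0 0.
have [a] := card_gt_notin (b := map bad (l :: L)) Fk ltac:(by rewrite size_map).
have good l' : (l' *m x != 0) || (l' *m y != 0) -> a != bad l' ->
    l' *m (x + a *: y) != 0.
  move=> nz; apply: contra => /eqP; rewrite mulmxDr -scalemxAr => e0.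
  have {}e0 : (l' *m x) 0 0 + a * (l' *m y) 0 0 = 0.
    by move/matrixP/(_ 0 0): e0; rewrite !mxE.
  have nzy : (l' *m y) 0 0 != 0.
    apply: contraTneq nz => y0; move: e0; rewrite y0 mulr0 addr0 => x0.
    by rewrite [l' *m x]mx11_scalar [l' *m y]mx11_scalar x0 y0 !raddf0 eqxx.
  rewrite /bad; apply/eqP; apply: (mulIf nzy).
  by rewrite mulfVK //; apply/eqP; rewrite -addr_eq0 addrC e0.
rewrite inE negb_or => /andP[al aL].
exists (x + a *: y); rewrite good ?andTb //=; last first.
  by apply/orP; right; apply: contraNneq ly => ->; rewrite mxE.
apply/allP=> l' l'L; apply: good; first by rewrite (allP Hx).
by apply: contraNneq aL => ->; apply: map_f.
Qed.

(** If every row carried a nonzero matrix of [V] supported on it alone, scaling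
    these matrices independently would produce the eigenvalue -1, since each of
    them controls one coordinate of the image of a generic vector. *)
Lemma exists_row_avoiding_index (F : fieldType) n (V : {vspace 'M[F]_n.+1}) :
    card_gt F n.+1 -> {in V, forall M, 1%:M + M \in unitmx} ->
  exists i : 'I_n.+1, (V :&: lker (linfun (row' i)))%VS = 0%VS.
Proof.
move=> Fn Vunit.
pose W i := (V :&: lker (linfun (row' (i : 'I_n.+1))))%VS.
case: (pickP (fun i => W i == 0%VS)) => [i /eqP|] Wi; first by exists i.
pose M i := vpick (W i).
have MV i : M i \in V by have := memv_pick (W i); rewrite memv_cap => /andP[].
have Mrow i k : k != i -> row k (M i) = 0.
  have := memv_pick (W i); rewrite memv_cap memv_ker lfunE /= => /andP[_ /eqP M0].
  case: (unliftP i k) => [k' ->|-> /eqP//] _.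
  by apply/rowP=> j; move/matrixP/(_ k' j): M0; rewrite !mxE.
have Mi i : row i (M i) != 0.
  apply/negP=> /eqP Mi0; have /negP := Wi i; rewrite -vpick0; apply.
  apply/eqP/row_matrixP=> k; rewrite row0.
  by have [->|/Mrow] := eqVneq k i.
have [||x] := @exists_generic_vector F n.+1 [seq row i (M i) | i <- enum 'I_n.+1].
- by rewrite size_map size_enum_ord.
- by apply/allP=> _ /mapP[i _ ->] /=.
move/allP=> nz; have {}nz i : (M i *m x) i 0 != 0.
  have := nz _ (map_f _ (mem_enum _ i)); apply: contra => /eqP e.
  by apply/eqP/matrixP=> a b; rewrite !ord1 -row_mul !mxE -[RHS]e mxE.
(* M i *m x is supported on coordinate i, so these weights give N *m x = - x. *)
pose N := \sum_i (- x i 0 / (M i *m x) i 0) *: M i.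
have NV : N \in V by apply: memv_suml => i _; apply: memvZ.
have Nx : (1%:M + N) *m x = 0.
  apply/colP=> k; rewrite mulmxDl mul1mx mulmx_suml [LHS]mxE summxE (bigD1 k) //=.
  rewrite big1 => [|i neq_ik].
    by rewrite -scalemxAl [X in _ + (X + _)]mxE mulfVK // addr0 subrr mxE.
  rewrite -scalemxAl mxE; apply/eqP; rewrite mulf_eq0; apply/orP; right.
  have := Mrow i k; rewrite eq_sym => /(_ neq_ik) r0.
  have -> : (M i *m x) k 0 = (row k (M i) *m x) 0 0 by rewrite -row_mul [RHS]mxE.
  by rewrite r0 mul0mx mxE.
have x0 : x = 0 by rewrite -[x](mulKmx (Vunit _ NV)) Nx mulmx0.
by have := nz ord0; rewrite x0 mulmx0 mxE eqxx.
Qed.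

(** The hypothesis says that no element of [V] has a nonzero eigenvalue, as [V]
    is stable under scaling.  The bound is that of the strictly triangular
    matrices. *)
Lemma dim_le_of_unit_translate (F : fieldType) n (V : {vspace 'M[F]_n}) :
    card_gt F n -> {in V, forall M, 1%:M + M \in unitmx} ->
  (\dim V <= 'C(n, 2))%N.
Proof.
elim: n V => [|n IHn] V Fn Vunit.
  by have := dimvS (subvf V); rewrite dimvf dim_matrix.
have [i Wi0] := exists_row_avoiding_index Fn Vunit.
pose f := linfun (row' i \o col i : 'M[F]_n.+1 -> 'cV_n).
pose g := linfun (row' i \o col' i : 'M[F]_n.+1 -> 'M_n).
pose U := (V :&: lker f)%VS.
have UP M : M \in U -> M \in V /\ forall k, M (lift i k) i = 0.
  rewrite memv_cap memv_ker lfunE => /andP[MV /eqP M0]; split=> // k.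
  by move/matrixP/(_ k 0): M0; rewrite !mxE.
(* Column i of M vanishes off the diagonal: expand along it. *)
have detU M : M \in U -> \det (1%:M + M) = (1 + M i i) * \det (1%:M + g M).
  move=> /UP[_ M0]; rewrite (expand_det_col _ i) (bigD1 i) //= big1 => [|k].
    rewrite !mxE eqxx addr0 /cofactor addnn -signr_odd odd_double mul1r.
    congr (_ * \det _); apply/matrixP=> a b.
    by rewrite lfunE !mxE (inj_eq lift_inj).
  case: (unliftP i k) => [k' ->|-> /eqP//] _.
  by rewrite !mxE M0 eq_sym (negPf (neq_lift _ _)) addr0 mul0r.
have Uii M : M \in U -> M i i = 0.
  move=> MU; apply/eqP/negPn/negP=> nz.
  have tU : (- (M i i)^-1) *: M \in U by apply: memvZ.
  have := Vunit _ (UP _ tU).1; rewrite unitmxE (detU _ tU).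
  by rewrite mxE mulNr mulVf // subrr mul0r unitr0.
have gU : (\dim (g @: U) <= 'C(n, 2))%N.
  apply: IHn => [|_ /memv_imgP[M MU ->]].
    by case: Fn => s [us lt]; exists s; split=> //; apply: ltnW.
  have := Vunit _ (UP _ MU).1.
  by rewrite !unitmxE (detU _ MU) (Uii _ MU) addr0 mul1r.
have inj_g : (U :&: lker g = 0)%VS.
  apply/eqP; rewrite -subv0 -Wi0; apply/subvP=> M.
  rewrite memv_cap => /andP[/UP[MV M0]].
  rewrite memv_ker lfunE /= => /eqP gM0; rewrite memv_cap MV memv_ker lfunE /=.
  apply/eqP/matrixP=> a b; rewrite !mxE.
  case: (unliftP i b) => [b' ->|->]; last exact: M0.
  by move/matrixP/(_ a b'): gM0; rewrite !mxE.
rewrite -(limg_ker_dim f V) -/U -(limg_dim_eq inj_g) binS bin1 leq_add //.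
by apply: leq_trans (dimvS (subvf _)) _; rewrite dimvf dim_matrix mulr1.
Qed.

(** * The pencil spanned by a rank idempotent and a matrix *)

Lemma size_det_le (R : comNzRingType) n (M : 'M[{poly R}]_n) (w : 'I_n -> nat) :
    (forall i j, size (M i j) <= (w j).+1)%N ->
  (size (\det M) <= (\sum_j w j).+1)%N.
Proof.
move=> le_M; rewrite -det_tr /determinant.
apply: leq_trans (size_sum _ _ _) _; apply/bigmax_leqP=> s _.
rewrite -signr_odd.
have -> (b : bool) (q : {poly R}) : size ((-1) ^+ b * q) = size q.
  by case: b; rewrite ?mul1r // expr1 mulN1r size_polyN.
apply: leq_trans (size_poly_prod_leq _ _) _.
rewrite leq_subLR addnS ltnS card_ord.
apply: (@leq_trans (\sum_(j < n) (w j).+1)); first by apply: leq_sum => j _; rewrite mxE.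
rewrite (eq_bigr (fun j => 1 + w j)%N) // big_split /= sum_nat_const card_ord muln1.
by [].
Qed.

(** The determinant is a polynomial in [t] of degree at most [r], because the
    last column is constant; the field has more than [r] nonzero elements. *)
Lemma det_pencil_eq0 (F : fieldType) r (A B : 'M[F]_(r + 1, r)) (c : 'cV_(r + 1)) :
    card_gt F r.+1 ->
    (forall t, t != 0 -> \det (row_mx (A + t *: B) c) = 0) ->
  \det (row_mx A c) = 0.
Proof.
case=> s [us lt_s] det0.
pose P : 'M[{poly F}]_(r + 1) :=
  row_mx (map_mx polyC A + 'X *: map_mx polyC B) (map_mx polyC c).
have Pt t : (\det P).[t] = \det (row_mx (A + t *: B) c).
  rewrite -horner_evalE -det_map_mx; congr (\det _).
  rewrite map_row_mx; congr row_mx; apply/matrixP=> i j;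
    by rewrite !mxE /= ?horner_evalE !hornerE.
suff P0 : \det P = 0 by rewrite -[A]addr0 -(scale0r B) -Pt P0 horner0.
have szP : (size (\det P) <= r.+1)%N.
  pose w (j : 'I_(r + 1)) : nat := (if split j is inl _ then 1 else 0)%N.
  have sum_w : (\sum_j w j = r)%N.
    rewrite big_split_ord /= big_ord1 /w (eq_bigr (fun=> 1%N)) => [|i _].
      by rewrite sum_nat_const card_ord muln1 (unsplitK (inr _)) addn0.
    by rewrite (unsplitK (inl _)).
  rewrite -[X in (_ <= X.+1)%N]sum_w; apply: size_det_le => i j.
  rewrite mxE /w; case: split => j'; rewrite !mxE.
    apply: leq_trans (size_polyD _ _) _; rewrite geq_max.
    rewrite (leq_trans (size_polyC_leq1 _)) //= mulrC.
    apply: leq_trans (size_polyMleq _ _) _.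
    by rewrite size_polyX addn2 /= ltnS size_polyC_leq1.
  exact: size_polyC_leq1.
(* Zero has to be discarded: the determinant is only known to vanish off it. *)
pose s1 := rem 0 s.
have sz1 : (r < size s1)%N.
  have [s0|s0] := boolP (0 \in s); last by rewrite /s1 rem_id // ltnW.
  by rewrite /s1 size_rem // ltn_predRL.
apply/eqP/negPn/negP=> nzP; have := max_poly_roots nzP (rs := s1).
rewrite rem_uniq // => /(_ _ isT) H.
have {}H : (size s1 < size (\det P))%N.
  apply: H; apply/allP=> t; rewrite mem_rem_uniq // inE => /andP[nz_t _].
  by rewrite /root Pt det0.
by have := leq_trans (leq_ltn_trans sz1 H) szP; rewrite ltnn.
Qed.

(** The determinant of the pencil is [t] times that of a pencil with last column
    [col_mx c d], whose value at [t = 0] is the determinant of [d].  Once [d] is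
    zero, the last row has a factor [t] as well, and what remains takes at
    [t = 0] the value of the determinant of [- (b *m c)]. *)
Lemma border_of_rank_pencil1 (F : fieldType) r
    (K : 'M[F]_r) (c : 'cV_r) (b : 'rV_r) (d : 'M_1) :
    card_gt F r.+1 ->
    (forall t, (\rank (pid_mx r + t *: block_mx K c b d)%R <= r)%N) ->
  d = 0 /\ b *m c = 0.
Proof.
move=> Fr rk.
have det0 t : \det (pid_mx r + t *: block_mx K c b d) = 0.
  apply/eqP/negPn/negP=> nz; have := rk t; rewrite mxrank_unit.
    by rewrite addn1 ltnn.
  by rewrite unitmxE unitfE.
have colt t : pid_mx r + t *: block_mx K c b d =
    row_mx (col_mx 1%:M 0 + t *: col_mx K b) (col_mx c d) *m block_mx 1%:M 0 0 t%:M.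
  rewrite pid_mx_block scale_block_mx add_block_mx !scale_col_mx !add_col_mx.
  rewrite -block_mxEh mulmx_block.
  by rewrite !mulmx1 !mulmx0 !mul_mx_scalar !addr0 !add0r.
have d0 : d = 0.
  have : \det (row_mx (col_mx 1%:M 0) (col_mx c d)) = 0.
    apply: (det_pencil_eq0 (B := col_mx K b)) Fr _ => t nz_t.
    have := det0 t; rewrite colt det_mulmx det_ublock det1 det_scalar1 mul1r.
    by move/eqP; rewrite mulf_eq0 (negPf nz_t) orbF => /eqP.
  rewrite -block_mxEh det_ublock det1 mul1r det_mx11 => d00.
  by rewrite [d]mx11_scalar d00 raddf0.
split=> //; subst d.
have rowt t : row_mx (col_mx 1%:M 0 + t *: col_mx K b) (col_mx c 0) =
    block_mx 1%:M 0 0 t%:M *m row_mx (col_mx 1%:M b + t *: col_mx K 0) (col_mx c 0).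
  rewrite !scale_col_mx !add_col_mx -!block_mxEh mulmx_block.
  by rewrite !mul1mx !mul0mx !mulmx0 !mul_scalar_mx !scaler0 !addr0 !add0r.
have : \det (row_mx (col_mx 1%:M b) (col_mx c 0)) = 0.
  apply: (det_pencil_eq0 (B := col_mx K 0)) Fr _ => t nz_t.
  have := det0 t; rewrite colt rowt !det_mulmx det_ublock det1 det_scalar1 mul1r.
  by move/eqP; rewrite !mulf_eq0 (negPf nz_t) orbF => /eqP.
have -> : row_mx (col_mx 1%:M b) (col_mx c 0) =
    block_mx 1%:M 0 b 1%:M *m block_mx 1%:M c 0 (- (b *m c)) :> 'M_(r + 1).
  by rewrite -block_mxEh mulmx_block !mul1mx !mul0mx !mulmx1 !addr0 subrr.
rewrite det_mulmx det_lblock det_ublock !det1 !mul1r det_mx11 => bc0.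
by apply/eqP; rewrite -oppr_eq0 [- _]mx11_scalar bc0 raddf0.
Qed.

(** Bordering the identity block with one row and one column at a time reduces
    this to the case [m = q = 1]. *)
Lemma border_of_rank_pencil (F : fieldType) r m q
    (K : 'M[F]_r) (C : 'M_(r, q)) (B : 'M_(m, r)) (D : 'M_(m, q)) :
    card_gt F r.+1 ->
    (forall t, (\rank (pid_mx r + t *: block_mx K C B D)%R <= r)%N) ->
  D = 0 /\ B *m C = 0.
Proof.
move=> Fr rk.
have Hij i j : row i (col j D) = 0 /\ row i B *m col j C = 0.
  apply: (@border_of_rank_pencil1 F r K) Fr _ => t.
  pose P : 'M[F]_(r + 1, r + m) := block_mx 1%:M 0 0 (delta_mx 0 i).
  pose Q : 'M[F]_(r + q, r + 1) := block_mx 1%:M 0 0 (delta_mx j 0).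
  suff -> : pid_mx r + t *: block_mx K (col j C) (row i B) (row i (col j D))
      = P *m (pid_mx r + t *: block_mx K C B D) *m Q.
    by apply: leq_trans (mxrankM_maxl _ _) _; apply: leq_trans (mxrankM_maxr _ _) _.
  rewrite !pid_mx_block !scale_block_mx !add_block_mx !add0r !mulmx_block.
  rewrite !mul1mx !mul0mx !mulmx0 !mulmx1 !addr0 !add0r.
  by rewrite !rowE !colE -!scalemxAr -!scalemxAl mulmxA.
split; apply/matrixP=> i j; have [d0 bc0] := Hij i j.
  by move/matrixP/(_ 0 0): d0; rewrite !mxE.
by rewrite -row_mul colE mulmxA -colE in bc0; move/matrixP/(_ 0 0): bc0; rewrite !mxE.
Qed.

(** * The upper bound *)

Lemma mxvec_dot (R : comNzRingType) m n (A : 'M[R]_(m, n)) (B : 'M_(n, m)) :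
  (mxvec A *m (mxvec B^T)^T) 0 0 = \tr (A *m B).
Proof.
rewrite mxE (reindex _ (curry_mxvec_bij m n)) /=.
rewrite (eq_bigr (fun ij => A ij.1 ij.2 * B ij.2 ij.1)) => [|[i j] _] /=.
  rewrite -(pair_bigA _ (fun i j => A i j * B j i)) /=.
  by apply: eq_bigr => i _; rewrite mxE.
by rewrite !mxE !mxvecE mxE.
Qed.

Lemma row_basis_mx (F : fieldType) n (U : {vspace 'rV[F]_n}) :
  exists X : 'M_(\dim U, n), \rank X = \dim U /\ forall i, row i X \in U.
Proof.
exists (\matrix_i (vbasis U)`_i); split=> [|i]; last first.
  by rewrite rowK vbasis_mem // mem_nth // size_tuple.
apply/eqP; rewrite -/(row_free _) -kermx_eq0; apply/eqP/row_matrixP => i.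
have /sub_kermxP := row_sub i (kermx (\matrix_(i < \dim U) (vbasis U)`_i)).
set v := row i _; rewrite mulmx_sum_row row0 => v0.
apply/rowP=> j; rewrite [RHS]mxE.
have /freeP fr := basis_free (vbasisP U).
apply: (fr (fun k => v 0 k) _ j).
by rewrite -[RHS]v0; apply: eq_bigr => k _; rewrite rowK.
Qed.

(** Padding the matrices [C] with zero columns makes the two spaces orthogonal for
    the trace pairing, which is a perfect pairing in dimension [r * m]. *)
Lemma dim_annihilating_pair (F : fieldType) m r q
    (UB : {vspace 'M[F]_(m, r)}) (UC : {vspace 'M[F]_(r, q)}) :
    (q <= m)%N -> {in UB & UC, forall B C, B *m C = 0} ->
  (\dim UB + \dim UC <= r * m)%N.
Proof.
move=> le_qm BC0.
pose f := linfun (mxvec : 'M[F]_(m, r) -> _).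
(* Multiplying by pid_mx q pads C with zero columns to the shape of B^T. *)
pose g := linfun (mxvec \o trmx \o mulmxr (pid_mx q : 'M[F]_(q, m))
  : 'M[F]_(r, q) -> 'rV_(m * r)).
have dimf : \dim (f @: UB) = \dim UB.
  apply/limg_dim_eq/eqP; rewrite -subv0; apply/subvP=> B.
  by rewrite memv_cap memv_ker lfunE /= memv0 mxvec_eq0 => /andP[].
have dimg : \dim (g @: UC) = \dim UC.
  apply/limg_dim_eq/eqP; rewrite -subv0; apply/subvP=> C.
  rewrite memv_cap memv_ker lfunE /= memv0 mxvec_eq0 trmx_eq0 => /andP[_ /eqP].
  move/(congr1 (mulmx^~ (pid_mx q : 'M_(m, q)))).
  by rewrite -mulmxA pid_mx_id // pid_mx_1 mulmx1 mul0mx => ->.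
have [X [rkX XU]] := row_basis_mx (f @: UB).
have [Y [rkY YU]] := row_basis_mx (g @: UC).
have XY0 : X *m Y^T = 0.
  apply/matrixP=> i j.
  have -> : (X *m Y^T) i j = (row i X *m (row j Y)^T) 0 0.
    by rewrite !mxE; apply: eq_bigr => k _; rewrite !mxE.
  have /memv_imgP[B BU ->] := XU i; have /memv_imgP[C CU ->] := YU j.
  by rewrite !lfunE /= mxvec_dot mulmxA BC0 // mul0mx mxtrace0 mxE.
have := mulmx0_rank_max XY0; rewrite mxrank_tr rkX rkY dimf dimg.
by rewrite [(r * m)%N]mulnC.
Qed.

(** The total dimension is split along the lower left block, then the upper
    right one, then the upper left one; the lower right block is always zero. *)
Lemma dim_pid_pencil_le (F : fieldType) r m q (V : {vspace 'M[F]_(r + m, r + q)}) :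
    card_gt F r.+1 -> (q <= m)%N ->
    {in V, forall N, \rank (pid_mx r + N)%R = r} ->
  (\dim V <= 'C(r, 2) + r * m)%N.
Proof.
move=> Fr le_qm rkV.
have blocks N : N \in V -> drsubmx N = 0 /\ dlsubmx N *m ursubmx N = 0.
  move=> NV; apply: (@border_of_rank_pencil F r m q (ulsubmx N)) Fr _ => t.
  by rewrite submxK rkV // memvZ.
pose fB := linfun (lsubmx \o dsubmx : 'M[F]_(r + m, r + q) -> 'M_(m, r)).
pose fC := linfun (rsubmx \o usubmx : 'M[F]_(r + m, r + q) -> 'M_(r, q)).
pose fK := linfun (lsubmx \o usubmx : 'M[F]_(r + m, r + q) -> 'M_r).
pose V1 := (V :&: lker fB)%VS; pose V2 := (V1 :&: lker fC)%VS.
have V1P N : N \in V1 -> N \in V /\ dlsubmx N = 0.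
  by rewrite memv_cap memv_ker lfunE => /andP[? /eqP].
have V2P N : N \in V2 -> N \in V /\ N = block_mx (ulsubmx N) 0 0 0.
  rewrite memv_cap memv_ker lfunE => /andP[/V1P[NV N0] /eqP C0]; split=> //.
  by rewrite -[LHS]submxK N0 (blocks N NV).1 [ursubmx N]C0.
have injK : (V2 :&: lker fK = 0)%VS.
  apply/eqP; rewrite -subv0; apply/subvP=> N.
  rewrite memv_cap memv_ker lfunE memv0 => /andP[/V2P[_ eN] /eqP K0].
  by rewrite eN [ulsubmx N]K0 block_mx0.
have dimK : (\dim (fK @: V2) <= 'C(r, 2))%N.
  apply: dim_le_of_unit_translate => [|_ /memv_imgP[N /V2P[NV eN] ->]].
    by case: Fr => s [us lt]; exists s; split=> //; apply: ltnW.
  have := rkV N NV; rewrite eN lfunE /= pid_mx_block add_block_mx !addr0.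
  rewrite rank_diag_block_mx mxrank0 addn0 => rk.
  by rewrite -row_full_unit /row_full -[lsubmx _]/(ulsubmx _) block_mxKul rk.
have dimBC : (\dim (fB @: V) + \dim (fC @: V1) <= r * m)%N.
  apply: dim_annihilating_pair le_qm _.
  move=> _ _ /memv_imgP[N NV ->] /memv_imgP[N' N'V1 ->].
  have [N'V dl0] := V1P _ N'V1.
  have := (blocks (N + N') (memvD NV N'V)).2.
  rewrite !lfunE /= -[lsubmx _]/(dlsubmx _) -[rsubmx _]/(ursubmx _).
  have -> : dlsubmx (N + N') = dlsubmx N.
    by rewrite /dlsubmx !linearD /= -!/(dlsubmx _) dl0 addr0.
  have -> : ursubmx (N + N') = ursubmx N + ursubmx N'.
    by rewrite /ursubmx !linearD.
  by rewrite mulmxDr (blocks N NV).2 add0r.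
rewrite -(limg_ker_dim fB V) -/V1 -(limg_ker_dim fC V1) -/V2 -(limg_dim_eq injK).
by rewrite -addnA leq_add // addnC.
Qed.

Lemma constant_rank_dim_le (F : fieldType) n p r (A : 'M[F]_(n, p))
    (V : {vspace 'M[F]_(n, p)}) :
    card_gt F r.+1 -> (p <= n)%N -> (r <= p)%N ->
    {in V, forall N, \rank (A + N)%R = r} ->
  (\dim V <= 'C(r, 2) + r * (n - r))%N.
Proof.
move=> Fr le_pn le_rp rkV.
have def_n := subnKC (leq_trans le_rp le_pn); have def_p := subnKC le_rp.
have : (p - r <= n - r)%N by rewrite leq_sub2r.
move: (n - r)%N (p - r)%N def_n def_p => m q def_n def_p; subst n p => le_qm.
have rkA : \rank A = r by rewrite -[A]addr0 rkV ?mem0v.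
(* A = L *m pid_mx r *m R with L and R invertible. *)
have := mulmx_ebase A; rewrite rkA; move: (col_ebase_unit A) (row_ebase_unit A).
move: (col_ebase A) (row_ebase A) => L R Lu Ru defA.
pose f := linfun (mulmxr (invmx R) \o mulmx (invmx L)
  : 'M[F]_(r + m, r + q) -> 'M_(r + m, r + q)).
have fK N : L *m f N *m R = N by rewrite lfunE /= mulmxA (mulmxKV Ru) (mulKVmx Lu).
have injf : (V :&: lker f = 0)%VS.
  apply/eqP; rewrite -subv0; apply/subvP=> N.
  rewrite memv_cap memv_ker memv0 => /andP[_ /eqP N0].
  by rewrite -[N]fK N0 mulmx0 mul0mx.
rewrite -(limg_dim_eq injf); apply: dim_pid_pencil_le => // _ /memv_imgP[N NV ->].
rewrite -[RHS](rkV N NV) -[in RHS](fK N) -[in RHS]defA -mulmxDl -mulmxDr.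
rewrite mxrankMfree ?row_free_unit // -[RHS]mxrank_tr trmx_mul.
by rewrite mxrankMfree ?row_free_unit ?unitmx_tr // mxrank_tr.
Qed.

(** * A space of maximal dimension *)

Lemma coordinate_subspace (F : fieldType) n p (P : {pred 'I_n * 'I_p}) :
  exists V : {vspace 'M[F]_(n, p)},
    \dim V = #|P| /\ forall N i j, N \in V -> (i, j) \notin P -> N i j = 0.
Proof.
pose E (k : 'I_#|P|) : 'M[F]_(n, p) := delta_mx (enum_val k).1 (enum_val k).2.
pose f := linfun (vec_mx \o mulmxr (\matrix_k mxvec (E k))
  : 'rV[F]_#|P| -> 'M[F]_(n, p)).
have fE x i j : f x i j = \sum_k x 0 k * ((i, j) == enum_val k)%:R.
  rewrite lfunE /= mxE mxE; apply: eq_bigr => k _.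
  by rewrite mxE mxvecE mxE -xpair_eqE -surjective_pairing.
exists (limg f); split=> [|_ i j /memv_imgP[x _ ->] nPij].
  rewrite limg_dim_eq ?dimvf ?dim_matrix ?mul1r //.
  apply/eqP; rewrite -subv0; apply/subvP=> x.
  rewrite memv_cap memv_ker memv0 => /andP[_ /eqP x0].
  apply/eqP/rowP=> k; rewrite [RHS]mxE.
  have := fE x (enum_val k).1 (enum_val k).2; rewrite x0 mxE.
  rewrite (bigD1 k) //= -surjective_pairing eqxx mulr1 big1 => [|k' nk].
    by rewrite addr0.
  by rewrite (inj_eq enum_val_inj) eq_sym (negPf nk) mulr0.
rewrite fE big1 // => k _.
case: eqP => [eij|_]; last by rewrite mulr0.
by rewrite eij enum_valP in nPij.
Qed.

Lemma card_strictly_lower n p r : (r <= p)%N -> (p <= n)%N ->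
  #|[pred ij : 'I_n * 'I_p | (ij.2 < r)%N && (ij.2 < ij.1)%N]|
    = ('C(r, 2) + r * (n - r))%N.
Proof.
move=> le_rp le_pn; rewrite -sum1_card.
rewrite (reindex_onto (fun ji : 'I_p * 'I_n => (ji.2, ji.1)) (fun ij => (ij.2, ij.1)))
  /=; last by case.
rewrite (eq_bigl (fun ji : 'I_p * 'I_n => (ji.1 < r)%N && (ji.1 < ji.2)%N)); last first.
  by case=> j i; rewrite !inE eqxx andbT.
rewrite -(pair_big_dep (fun j : 'I_p => (j < r)%N)
  (fun (j : 'I_p) (i : 'I_n) => (j < i)%N) (fun _ _ => 1%N)) /=.
rewrite (eq_bigr (fun j : 'I_p => n - j.+1)%N) => [|j lt_jr]; last first.
  transitivity (\sum_(j.+1 <= i < n) 1)%N; first by rewrite big_geq_mkord.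
  by rewrite sum_nat_const_nat muln1.
rewrite -(big_ord_widen_cond p xpredT (fun j => n - j.+1)%N le_rp) /=.
elim: r le_rp => [|r IHr] lt_rp; first by rewrite big_ord0.
rewrite big_ord_recr /= IHr ?(ltnW lt_rp) // binS bin1 mulSn.
have lt_rn := leq_trans lt_rp le_pn.
rewrite -[(n - r)%N]prednK ?subn_gt0 // -subnS mulnS.
by rewrite -!addnA; congr (_ + _)%N; congr (_ + _)%N; rewrite addnC.
Qed.

(** [N] is unchanged by [pid_mx r] on its right, so [pid_mx r] factors out of the
    sum and leaves a unitriangular matrix on its left. *)
Lemma rank_pid_add_strictly_lower (F : fieldType) n p r (N : 'M[F]_(n, p)) :
    (r <= p)%N -> (p <= n)%N ->
    (forall (i : 'I_n) (j : 'I_p), ~~ ((j < r)%N && (j < i)%N) -> N i j = 0) ->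
  \rank (pid_mx r + N)%R = r.
Proof.
move=> le_rp le_pn N0.
have le_rn := leq_trans le_rp le_pn.
have Npid : N *m (pid_mx r : 'M_p) = N.
  apply/matrixP=> i j; rewrite mxE (bigD1 j) //= big1 => [|k nkj].
    rewrite !mxE eqxx /= addr0; have [_|ge_jr] := ltnP j r; first by rewrite mulr1.
    by rewrite mulr0 N0 // ltnNge ge_jr.
  by rewrite !mxE (negPf (nkj : val k != val j)) mulr0.
pose T : 'M[F]_n := 1%:M + N *m (pid_mx r : 'M_(p, n)).
have Nij (i j : 'I_n) : (i <= j)%N -> (N *m (pid_mx r : 'M_(p, n))) i j = 0.
  move=> le_ij; rewrite mxE big1 // => k _; rewrite !mxE.
  have [ekj|_] := eqVneq (val k) j; last by rewrite mulr0.
  by rewrite N0 ?mul0r // (ekj : k = j :> nat) negb_and -!leqNgt le_ij orbT.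
have Tu : T \in unitmx.
  rewrite unitmxE det_trig; last first.
    apply/is_trig_mxP=> i j lt_ij; rewrite mxE Nij ?(ltnW lt_ij) // mxE addr0.
    by rewrite -val_eqE /= ltn_eqF.
  by rewrite big1 ?unitr1 // => i _; rewrite mxE Nij // mxE eqxx addr0.
have -> : pid_mx r + N = T *m (pid_mx r : 'M_(n, p)).
  by rewrite mulmxDl mul1mx -mulmxA pid_mx_id // Npid.
rewrite -mxrank_tr trmx_mul mxrankMfree ?row_free_unit ?unitmx_tr //.
by rewrite mxrank_tr rank_pid_mx.
Qed.

Theorem theorem1p2 (F : fieldType) (n p r : nat)
    (hr : (0 < r)%N) (hrp : (r <= p)%N) (hpn : (p <= n)%N)
    (hF : card_gt F (r + 1)) :
  max_constant_rank_affine_dim F n p r ('C(r, 2) + r * (n - r))%N.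
Proof.
split=> [|d [S [[A [V [defS <-]]] rkS]]].
  have [V [dimV V0]] := coordinate_subspace F
    [pred ij : 'I_n * 'I_p | (ij.2 < r)%N && (ij.2 < ij.1)%N].
  exists (translate (pid_mx r) V); split.
    by exists (pid_mx r), V; split; rewrite // dimV card_strictly_lower.
  move=> M MV; rewrite -(subrKC (pid_mx r) M).
  by apply: rank_pid_add_strictly_lower => // i j; apply: V0.
apply: (@constant_rank_dim_le F n p r A) => //; first by rewrite -addn1.
by move=> N NV; apply: rkS; rewrite defS inE /= addrC addKr.
Qed.
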